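(* Let $(\mathfrak{g}_0,\sigma;\theta)$ be a non-compact semisimple symmetric pair equipped with a Cartan involution, and exclude the case where $\mathfrak{g}_0$ is simple without complex structures. If $(\mathfrak{g}_0,\sigma)$ is irreducible, then one of the following holds: (P-a) $\mathfrak{g}_0$ is a real simple Lie algebra with a complex structure and $\sigma$ is anti-linear on the complex Lie algebra $\mathfrak{g}_0$. (P-b) $\mathfrak{g}_0$ is a real simple Lie algebra with a complex structure and $\sigma$ is $\mathbb{C}$-linear on the complex Lie algebra $\mathfrak{g}_0$. (P-c) $(\mathfrak{g}_0,\sigma;\theta)\equiv(\mathfrak{g}_0'\oplus\mathfrak{g}_0',\ \rho;\ \theta|_{\mathfrak{g}_0'}\oplus\theta|_{\mathfrak{g}_0'})$ for some $\theta$-invariant simple ideal $\mathfrak{g}_0'$ of $\mathfrak{g}_0$ with a complex structure. (P-d) $(\mathfrak{g}_0,\sigma;\theta)\equiv(\mathfrak{g}_0'\oplus\mathfrak{g}_0',\ \rho;\ \theta|_{\mathfrak{g}_0'}\oplus\theta|_{\mathfrak{g}_0'})$ for some $\theta$-invariant simple ideal $\mathfrak{g}_0'$ of $\mathfrak{g}_0$ without complex structures.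
   Context: An involution on a real Lie algebra is an automorphism $\nu$ with $\nu^2=\operatorname{id}$. A non-compact semisimple symmetric pair equipped with a Cartan involution $(\mathfrak{g}_0,\sigma;\theta)$ consists of a non-compact real semisimple Lie algebra $\mathfrak{g}_0$, an involution $\sigma$ on it and a Cartan involution $\theta$ of $\mathfrak{g}_0$ with $\theta\sigma=\sigma\theta$. $(\mathfrak{g}_0,\sigma;\theta)\equiv(\mathfrak{g}_0'',\sigma'';\theta'')$ means there is a Lie algebra isomorphism $\varphi:\mathfrak{g}_0\to\mathfrak{g}_0''$ with $\varphi\sigma=\sigma''\varphi$ and $\varphi\theta=\theta''\varphi$. $(\mathfrak{g}_0,\sigma)$ is irreducible if $\mathfrak{g}_0$ has no $\sigma$-invariant ideals other than $\{0\}$ and $\mathfrak{g}_0$. A complex structure on a real Lie algebra is an $\mathbb{R}$-linear $J$ with $J^2=-\operatorname{id}$ making it a complex Lie algebra; $\sigma$ is $\mathbb{C}$-linear if $\sigma J=J\sigma$ and anti-linear if $\sigma J=-J\sigma$. On $\mathfrak{l}\oplus\mathfrak{l}$, $\rho(X,Y):=(Y,X)$ and $(\nu_1\oplus\nu_2)(X,Y):=(\nu_1(X),\nu_2(Y))$. *)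

(* Defs.v *)
From HB Require Import structures.
From mathcomp Require Import all_boot all_order all_algebra.
From mathcomp Require Import reals.

Set Implicit Arguments.
Unset Strict Implicit.
Unset Printing Implicit Defensive.

Import Order.TTheory GRing.Theory Num.Theory.
Import passmx.
Local Open Scope ring_scope.

HB.mixin Record isLieAlgebra (F : fieldType) (g : Type) of Vector F g := {
  lbr : g -> g -> g;
  lbr_linearl : forall y, linear (lbr^~ y);
  lbr_linearr : forall x, linear (lbr x);
  lbrxx : forall x, lbr x x = 0;
  lbr_jacobi : forall x y z,
    lbr x (lbr y z) + lbr y (lbr z x) + lbr z (lbr x y) = 0
}.

#[short(type="lieAlgType")]
HB.structure Definition LieAlgebra (F : fieldType) :=
  {g of isLieAlgebra F g & Vector F g}.

Notation "[ 'lie' x , y ]" := (lbr x y)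
  (at level 0, x, y at level 99, format "[ 'lie'  x ,  y ]") : ring_scope.

HB.instance Definition _ (F : fieldType) (g : lieAlgType F) (x : g) :=
  GRing.isLinear.Build F g g *:%R (lbr x) (lbr_linearr x).

Section DirectSum.
Variables (F : fieldType) (g h : lieAlgType F).
Implicit Types p q r : (g * h)%type.

Definition dsum_lbr p q : g * h := ([lie p.1, q.1], [lie p.2, q.2]).

Fact dsum_lbr_linearl q : linear (dsum_lbr^~ q).
Proof. by move=> a u v; congr pair; rewrite /= lbr_linearl. Qed.

Fact dsum_lbr_linearr p : linear (dsum_lbr p).
Proof. by move=> a u v; congr pair; rewrite /= lbr_linearr. Qed.

Fact dsum_lbrxx p : dsum_lbr p p = 0.
Proof. by congr pair; rewrite lbrxx. Qed.

Fact dsum_lbr_jacobi p q r :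
  dsum_lbr p (dsum_lbr q r) + dsum_lbr q (dsum_lbr r p)
    + dsum_lbr r (dsum_lbr p q) = 0.
Proof. by congr pair; rewrite /= lbr_jacobi. Qed.

HB.instance Definition _ := isLieAlgebra.Build F (g * h)%type
  dsum_lbr_linearl dsum_lbr_linearr dsum_lbrxx dsum_lbr_jacobi.

End DirectSum.

Record lieIdeal (F : fieldType) (g : lieAlgType F) := LieIdeal {
  ideal_vs :> {vspace g};
  idealP : forall x y, y \in ideal_vs -> [lie x, y] \in ideal_vs
}.

Section IdealLieAlgebra.
Variables (F : fieldType) (g : lieAlgType F) (I : lieIdeal g).
Implicit Types x y z : subvs_of I.

Definition ideal_lbr x y : subvs_of I := Subvs (idealP (vsval x) (subvsP y)).

Fact ideal_lbr_linearl y : linear (ideal_lbr^~ y).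
Proof. by move=> a u v; apply: val_inj; apply: lbr_linearl. Qed.

Fact ideal_lbr_linearr x : linear (ideal_lbr x).
Proof. by move=> a u v; apply: val_inj; apply: lbr_linearr. Qed.

Fact ideal_lbrxx x : ideal_lbr x x = 0.
Proof. by apply: val_inj; apply: lbrxx. Qed.

Fact ideal_lbr_jacobi x y z :
  ideal_lbr x (ideal_lbr y z) + ideal_lbr y (ideal_lbr z x)
    + ideal_lbr z (ideal_lbr x y) = 0.
Proof. by apply: val_inj; apply: lbr_jacobi. Qed.

HB.instance Definition _ := isLieAlgebra.Build F (subvs_of I)
  ideal_lbr_linearl ideal_lbr_linearr ideal_lbrxx ideal_lbr_jacobi.

End IdealLieAlgebra.

Section LieTheory.
Variables (F : fieldType) (g : lieAlgType F).

Definition lie_bracket_vs (U V : {vspace g}) : {vspace g} :=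
  <<[seq [lie x, y] | x <- vbasis U, y <- vbasis V]>>%VS.

Definition derived_series (n : nat) (U : {vspace g}) : {vspace g} :=
  iter n (fun V => lie_bracket_vs V V) U.

Definition lie_solvable (U : {vspace g}) : Prop :=
  exists n, derived_series n U = 0%VS.

Definition lie_semisimple : Prop :=
  forall I : lieIdeal g, lie_solvable I -> I = 0%VS :> {vspace g}.

Definition lie_abelian : Prop := forall x y : g, [lie x, y] = 0.

Definition lie_simple : Prop :=
  ~ lie_abelian /\
  forall I : lieIdeal g, I = 0%VS :> {vspace g} \/ I = fullv :> {vspace g}.

Definition ad (x : g) : 'End(g) := linfun (lbr x).

Lemma adE x y : ad x y = [lie x, y].
Proof. by rewrite lfunE. Qed.

Definition lfun_trace (f : 'End(g)) : F :=
  \tr (mxof (vbasis fullv) (vbasis fullv) f).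

Definition killing (x y : g) : F := lfun_trace (ad x \o ad y)%VF.

Definition stable_vs (f : 'End(g)) (U : {vspace g}) : Prop :=
  (f @: U <= U)%VS.

(* With i acting on g as J, the two bracket identities say that the bracket is
   C-bilinear. *)
Definition complex_structure (J : 'End(g)) : Prop :=
  [/\ forall x, J (J x) = - x,
      forall x y, [lie J x, y] = J [lie x, y]
    & forall x y, [lie x, J y] = J [lie x, y]].

Definition has_complex_structure : Prop := exists J, complex_structure J.

Definition complex_linear (J f : 'End(g)) : Prop :=
  forall x, f (J x) = J (f x).

Definition complex_antilinear (J f : 'End(g)) : Prop :=
  forall x, f (J x) = - J (f x).

End LieTheory.

Arguments lie_semisimple {F} g.
Arguments lie_abelian {F} g.
Arguments lie_simple {F} g.
Arguments has_complex_structure {F} g.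

Definition lie_isomorphism (F : fieldType) (g h : lieAlgType F)
    (f : 'Hom(g, h)) : Prop :=
  bijective f /\ forall x y, f [lie x, y] = [lie f x, f y].

Definition lie_involution (F : fieldType) (g : lieAlgType F)
    (nu : 'End(g)) : Prop :=
  lie_isomorphism nu /\ (nu \o nu)%VF = \1%VF.

Definition irreducible_pair (F : fieldType) (g : lieAlgType F)
    (sigma : 'End(g)) : Prop :=
  forall I : lieIdeal g, stable_vs sigma I ->
    I = 0%VS :> {vspace g} \/ I = fullv :> {vspace g}.

(* (g, sigma; theta) == (g', sigma'; theta') *)
Definition pair_equiv (F : fieldType) (g g' : lieAlgType F)
    (sigma theta : 'End(g)) (sigma' theta' : 'End(g')) : Prop :=
  exists phi : 'Hom(g, g'),
    [/\ lie_isomorphism phi,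
        (phi \o sigma = sigma' \o phi)%VF
      & (phi \o theta = theta' \o phi)%VF].

Section DirectSumMaps.
Variables (F : fieldType) (g : lieAlgType F).
Implicit Types (f h : 'End(g)) (p : (g * g)%type).

Definition swap_fun p : g * g := (p.2, p.1).
Definition dsum_fun f h p : g * g := (f p.1, h p.2).

Fact swap_fun_linear : linear swap_fun.
Proof. by []. Qed.
HB.instance Definition _ :=
  GRing.isLinear.Build F (g * g)%type (g * g)%type *:%R swap_fun
    swap_fun_linear.

Fact dsum_fun_linear f h : linear (dsum_fun f h).
Proof. by move=> a u v; congr pair; rewrite /= linearP. Qed.
HB.instance Definition _ f h :=
  GRing.isLinear.Build F (g * g)%type (g * g)%type *:%R (dsum_fun f h)
    (dsum_fun_linear f h).

Definition lie_swap : 'End((g * g)%type) := linfun swap_fun.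
Definition lfun_dsum f h : 'End((g * g)%type) := linfun (dsum_fun f h).

Lemma lie_swapE p : lie_swap p = (p.2, p.1).
Proof. by rewrite lfunE. Qed.

Lemma lfun_dsumE f h p : lfun_dsum f h p = (f p.1, h p.2).
Proof. by rewrite lfunE. Qed.

End DirectSumMaps.

Arguments lie_swap {F} g.

(* The restriction of f to U; meaningful when U is f-stable, since vsproj is
   then the identity on f @: U (lfun_restrE). *)
Definition lfun_restr (F : fieldType) (g : lieAlgType F) (f : 'End(g))
    (U : {vspace g}) : 'End(subvs_of U) :=
  linfun (vsproj U \o f \o vsval).

Lemma lfun_restrE (F : fieldType) (g : lieAlgType F) (f : 'End(g))
    (U : {vspace g}) (x : subvs_of U) :
  stable_vs f U -> vsval (lfun_restr f U x) = f (vsval x).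
Proof.
move=> fU; rewrite lfunE /= vsprojK //.
by apply: (subvP fU); rewrite memv_img // subvsP.
Qed.

Section RealLie.
Variables (R : realType) (g : lieAlgType R).

(* For semisimple g: compactness means that the Killing form is negative
   definite; in particular the zero algebra is compact. *)
Definition lie_compact : Prop := forall x : g, x != 0 -> killing x x < 0.

(* B_theta(x, y) = - B(x, theta y) is positive definite; its symmetry is
   automatic for an involutive automorphism. *)
Definition cartan_involution (theta : 'End(g)) : Prop :=
  lie_involution theta /\ forall x : g, x != 0 -> 0 < - killing x (theta x).

Record noncompact_semisimple_pair (sigma theta : 'End(g)) : Prop := {
  pair_semisimple : lie_semisimple g;
  pair_noncompact : ~ lie_compact;
  pair_involution : lie_involution sigma;
  pair_cartan : cartan_involution theta;
  pair_commute : (theta \o sigma = sigma \o theta)%VF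
}.

End RealLie.

(* Main.v *)
Require Import Defs.
From HB Require Import structures.
From mathcomp Require Import all_boot all_order all_algebra.
From mathcomp Require Import reals.
From mathcomp Require Import boolp.

Import Order.TTheory GRing.Theory Num.Theory.
Import passmx.
Local Open Scope ring_scope.

(** The argument splits on whether g0 is simple.

    If g0 is simple, the excluded case provides a complex structure J, and
    J' = sigma J sigma is a second one.  Both lie in the centroid of g0 (the
    endomorphisms commuting with every ad x), which is commutative by
    [centroidC]; hence (J' - J)(J' + J) = J'^2 - J^2 = 0.  Kernels of centroid
    elements are ideals, so J' - J is zero or injective: either J' = J (sigma
    is C-linear) or J' = - J (sigma is anti-linear), which is
    [complex_linear_or_antilinear].

    If g0 is not simple, let I be any nonzero proper ideal; there is one, as a
    nonzero semisimple algebra is not abelian.  The ideals I :&: sigma I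
    and I + sigma I are sigma-stable, so irreducibility forces
    g0 = I (+) sigma I.  The two summands commute, so an ideal K of I is an
    ideal of g0, and K + sigma K = g0 then forces K = I as soon as K <> 0:
    I is simple ([swapped_ideal_simple]).  If I and theta I met trivially, then
    ad x \o ad (theta x) would vanish for x in I, contradicting the positivity
    of - B(x, theta x); so I :&: theta I is a nonzero ideal inside I, hence is
    all of I ([swapped_ideal_theta_stable]).  Finally (x, y) |-> x + sigma y is
    an isomorphism from I (+) I to g0 that turns the swap into sigma and
    theta (+) theta into theta ([swapped_ideal_equiv]). *)

(** * Brackets and ideals *)

Section Ideals.
Context {F : fieldType} {g : lieAlgType F}.
Implicit Types (x y : g) (U V : {vspace g}) (I K : lieIdeal g) (f : 'End(g)).

Lemma lbrDl x y z : [lie x + y, z] = [lie x, z] + [lie y, z].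
Proof. by have := lbr_linearl z 1 x y; rewrite !scale1r. Qed.

Lemma lbrDr x y z : [lie z, x + y] = [lie z, x] + [lie z, y].
Proof. exact: linearD. Qed.

Lemma lbrC x y : [lie x, y] = - [lie y, x].
Proof.
apply/eqP; rewrite -addr_eq0.
by have := lbrxx (x + y); rewrite lbrDl !lbrDr !lbrxx add0r addr0 => ->.
Qed.

Lemma ideal_lbrl I x y : x \in ideal_vs I -> [lie x, y] \in ideal_vs I.
Proof. by move=> xI; rewrite lbrC memvN idealP. Qed.

Fact fullv_ideal_proof x y : y \in fullv -> [lie x, y] \in (fullv : {vspace g}).
Proof. by rewrite !memvf. Qed.
Definition full_ideal : lieIdeal g := LieIdeal fullv_ideal_proof.

Fact capv_ideal_proof I K x y : y \in (I :&: K)%VS -> [lie x, y] \in (I :&: K)%VS.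
Proof. by rewrite !memv_cap => /andP[yI yK]; rewrite !idealP. Qed.
Definition cap_ideal I K : lieIdeal g := LieIdeal (capv_ideal_proof I K).

Fact addv_ideal_proof I K x y : y \in (I + K)%VS -> [lie x, y] \in (I + K)%VS.
Proof.
by move=> /memv_addP[u uI [v vK ->]]; rewrite lbrDr memv_add ?idealP.
Qed.
Definition add_ideal I K : lieIdeal g := LieIdeal (addv_ideal_proof I K).

Definition centroid f := forall x y, f [lie x, y] = [lie x, f y].

Fact lker_ideal_proof {f} (fc : centroid f) x y :
  y \in lker f -> [lie x, y] \in lker f.
Proof. by rewrite !memv_ker fc => /eqP->; rewrite linear0. Qed.
Definition ker_ideal {f} (fc : centroid f) : lieIdeal g :=
  LieIdeal (lker_ideal_proof fc).

Lemma involution_lbr f x y :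
  lie_involution f -> f [lie x, y] = [lie f x, f y].
Proof. by move=> [[_ ->]]. Qed.

Lemma involutionK f : lie_involution f -> involutive f.
Proof. by move=> [_ ff] x; rewrite -comp_lfunE ff id_lfunE. Qed.

Fact limg_ideal_proof {f} (fi : lie_involution f) I x y :
  y \in (f @: I)%VS -> [lie x, y] \in (f @: I)%VS.
Proof.
move=> /memv_imgP[u uI ->]; rewrite -(involutionK _ fi x).
by rewrite -(involution_lbr _ _ _ fi) memv_img ?idealP.
Qed.
Definition img_ideal {f} (fi : lie_involution f) I : lieIdeal g :=
  LieIdeal (limg_ideal_proof fi I).

Lemma mem_img_involution f U x :
  lie_involution f -> (x \in (f @: U)%VS) = (f x \in U).
Proof.
move=> fi; apply/memv_imgP/idP => [[u uU ->]|fxU].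
  by rewrite (involutionK _ fi).
by exists (f x); rewrite ?(involutionK _ fi).
Qed.

(** The derived series of an abelian ideal reaches 0 after one step. *)
Lemma semisimple_abelian_ideal I :
    lie_semisimple g ->
    (forall x y, x \in ideal_vs I -> y \in ideal_vs I -> [lie x, y] = 0) ->
  I = 0%VS :> {vspace g}.
Proof.
move=> ss Iab; apply: ss; exists 1%N => /=; apply/eqP.
rewrite -subv0; apply/span_subvP => _ /allpairsP[[x y] /= [xI yI ->]].
by rewrite Iab ?mem0v //; apply: vbasis_mem.
Qed.

Lemma not_simple_proper_ideal :
    ~ lie_abelian g -> ~ lie_simple g ->
  exists I, I <> 0%VS :> {vspace g} /\ I <> fullv :> {vspace g}.
Proof.
move=> nab; apply: contra_notP => noI; split=> // I.
apply: contrapT => /not_orP nI; apply: noI; by exists I.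
Qed.

(** A product of two adjoint maps lands in the intersection of any two ideals
    containing their arguments, so its trace vanishes when these are
    disjoint. *)
Lemma killing_disjoint_ideals I K x y :
    (I :&: K = 0)%VS -> x \in ideal_vs I -> y \in ideal_vs K ->
  killing x y = 0.
Proof.
move=> IK0 xI yK; rewrite /killing.
suff -> : (ad x \o ad y)%VF = 0 by rewrite /lfun_trace !linear0.
apply/lfunP => z; rewrite comp_lfunE !adE zero_lfunE.
apply/eqP; rewrite -memv0 -IK0 memv_cap ideal_lbrl //=.
by rewrite idealP // ideal_lbrl.
Qed.

End Ideals.

(** * Simple algebras with a complex structure *)

Section Centroid.
Context {F : fieldType} {g : lieAlgType F}.
Hypothesis gs : lie_simple g.
Implicit Types f h J : 'End(g).

Lemma centroid_ker f : centroid f -> lker f = 0%VS \/ f = 0.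
Proof.
move=> fc; case: (gs.2 (ker_ideal fc)) => /= [|kerf]; [by left|right].
by apply/lfunP => x; rewrite zero_lfunE; apply/eqP; rewrite -memv_ker kerf memvf.
Qed.

(** On a bracket, f can act through one argument and h through the other, so
    their commutator, itself in the centroid, kills [g, g] <> 0; its kernel is
    then a nonzero ideal. *)
Lemma centroidC f h : centroid f -> centroid h -> (f \o h = h \o f)%VF.
Proof.
move=> fc hc; pose c := ((f \o h) - (h \o f))%VF.
have cE x : c x = f (h x) - h (f x).
  by rewrite add_lfunE opp_lfunE !comp_lfunE.
have cc : centroid c by move=> x y; rewrite !cE !(fc, hc) linearB.
have fl x y : f [lie x, y] = [lie f x, y] by rewrite lbrC linearN /= fc -lbrC.
apply/eqP; rewrite -subr_eq0 -/c; apply/eqP.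
have [kerc|//] := centroid_ker c cc.
case: gs.1 => x y; apply/eqP; rewrite -memv0 -kerc memv_ker cE.
by rewrite hc fl fl hc subrr.
Qed.

(** The factorisation (J' - J)(J' + J) = J'^2 - J^2 = 0, which needs J and J'
    to commute, in an algebra where J' - J is zero or injective. *)
Lemma complex_structure_pm J J' :
  complex_structure J -> complex_structure J' -> J' = J \/ J' = - J.
Proof.
move=> [JJ _ Jc] [JJ' _ Jc'].
have dc : centroid (J' - J)%VF.
  by move=> x y; rewrite !add_lfunE !opp_lfunE linearB /= Jc Jc'.
have JC : (J \o J' = J' \o J)%VF.
  by apply: centroidC => x y; rewrite ?Jc ?Jc'.
have [ker0|/eqP] := centroid_ker _ dc; last by rewrite subr_eq0 => /eqP; left.
right; apply/lfunP => x; rewrite opp_lfunE; apply/eqP; rewrite -addr_eq0 -memv0.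
rewrite -ker0 memv_ker add_lfunE opp_lfunE !linearD /= JJ JJ'.
have := congr1 (fun f : 'End(g) => f x) JC; rewrite !comp_lfunE => ->.
by rewrite opprK addrA addrK addNr.
Qed.

(** Conjugating by sigma transports a complex structure to another one. *)
Lemma complex_linear_or_antilinear J sigma :
    complex_structure J -> lie_involution sigma ->
  complex_linear J sigma \/ complex_antilinear J sigma.
Proof.
move=> Jcs si; have sK := involutionK _ si; have sL := involution_lbr _ _ _ si.
have J'cs : complex_structure (sigma \o J \o sigma)%VF.
  case: Jcs => JJ Jl Jr.
  split=> [x|x y|x y]; rewrite !comp_lfunE.
  - by rewrite sK JJ linearN /= sK.
  - by rewrite sL -Jl sL sK.
  - by rewrite sL -Jr sL sK.
have [JE|JE] := complex_structure_pm _ _ Jcs J'cs; [left|right] => x.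
  by rewrite -[in RHS]JE !comp_lfunE sK.
have := congr1 (fun f : 'End(g) => f (sigma x)) JE.
by rewrite opp_lfunE !comp_lfunE sK.
Qed.

End Centroid.

(** * Proper ideals of an irreducible pair *)

Section Irreducible.
Context {F : fieldType} {g : lieAlgType F} {sigma : 'End(g)}.
Hypothesis si : lie_involution sigma.
Hypothesis irr : irreducible_pair sigma.
Implicit Types I K : lieIdeal g.

Let sK : involutive sigma := involutionK _ si.

(** I + sigma I is a sigma-stable ideal, nonzero because it contains I; dually,
    I :&: sigma I below is stable and proper because I contains it. *)
Lemma irreducible_add_img I :
  I <> 0%VS :> {vspace g} -> (I + sigma @: I)%VS = fullv.
Proof.
move=> nz; case: (irr (add_ideal I (img_ideal si I))) => //=.
  rewrite /stable_vs limgD -limg_comp.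
  by case: si => _ ->; rewrite lim1g addvC.
by move=> sum0; case: nz; apply/eqP; rewrite -subv0 -sum0 addvSl.
Qed.

Lemma irreducible_cap_img I :
  I <> fullv :> {vspace g} -> (I :&: sigma @: I = 0)%VS.
Proof.
move=> nf; case: (irr (cap_ideal I (img_ideal si I))) => //=.
  apply/subvP => _ /memv_imgP[x + ->].
  by rewrite !memv_cap !mem_img_involution // sK andbC.
by move=> capf; case: nf; apply/eqP; rewrite eqEsubv subvf -capf capvSl.
Qed.

Context {I : lieIdeal g}.
Hypothesis I_neq0 : I <> 0%VS :> {vspace g}.
Hypothesis I_proper : I <> fullv :> {vspace g}.

Lemma swapped_ideal_decomp x :
  exists u v, [/\ u \in ideal_vs I, v \in ideal_vs I & x = u + sigma v].
Proof.
have /memv_addP[u uI [w wsI ->]] : x \in (I + sigma @: I)%VS.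
  by rewrite irreducible_add_img ?memvf.
exists u, (sigma w); rewrite sK; split=> //.
by rewrite -mem_img_involution.
Qed.

Lemma swapped_ideal_eq0 x :
  x \in ideal_vs I -> sigma x \in ideal_vs I -> x = 0.
Proof.
move=> xI sxI; apply/eqP; rewrite -memv0 -(irreducible_cap_img I) //.
by rewrite memv_cap mem_img_involution ?xI.
Qed.

(** The bracket lies in I and in sigma I, which meet trivially. *)
Lemma swapped_ideal_comm x y :
  x \in ideal_vs I -> y \in ideal_vs I -> [lie sigma x, y] = 0.
Proof.
move=> xI yI; apply: swapped_ideal_eq0; first exact: idealP.
by rewrite involution_lbr // sK ideal_lbrl.
Qed.

(** Since sigma I centralises I, an ideal K of I is an ideal of g; if it is
    nonzero then K + sigma K is everything, which leaves no room between K
    and I. *)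
Lemma swapped_ideal_minimal (K : {vspace g}) :
    (K <= I)%VS ->
    (forall x y, x \in ideal_vs I -> y \in K -> [lie x, y] \in K) ->
  K = 0%VS \/ K = I.
Proof.
move=> /subvP KI KIideal.
have Kideal x y : y \in K -> [lie x, y] \in K.
  have [u [v [uI vI ->]]] := swapped_ideal_decomp x => yK.
  by rewrite lbrDl swapped_ideal_comm //; [rewrite addr0 KIideal | exact: KI].
have [/eqP K0|/eqP K0] := boolP (K == 0%VS); [by left|right].
apply/eqP; rewrite eqEsubv; apply/andP; split; apply/subvP => // x xI.
have : x \in (K + sigma @: K)%VS.
  by rewrite (irreducible_add_img (LieIdeal Kideal) K0) memvf.
move=> /memv_addP[k kK [w wsK xE]].
suff w0 : w = 0 by rewrite xE w0 addr0.
rewrite mem_img_involution // in wsK.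
apply: swapped_ideal_eq0; last exact: KI.
by rewrite -(addKr k w) -xE memvD ?memvN //; apply: KI.
Qed.

Lemma swapped_ideal_simple : lie_semisimple g -> lie_simple (subvs_of I).
Proof.
move=> ss; split=> [ab|K].
  apply: I_neq0; apply: semisimple_abelian_ideal => // x y xI yI.
  by have := congr1 vsval (ab (Subvs xI) (Subvs yI)).
pose i : 'Hom(subvs_of I, g) := linfun vsval.
have iE x : i x = vsval x by rewrite lfunE.
have [||iK0|iKI] := swapped_ideal_minimal (i @: K)%VS.
- by apply/subvP => _ /memv_imgP[x _ ->]; rewrite iE subvsP.
- move=> x _ xI /memv_imgP[y yK ->]; rewrite iE.
  have -> : [lie x, vsval y] = i [lie Subvs xI, y] by rewrite iE.
  by rewrite memv_img ?idealP.
- left; apply/eqP; rewrite -subv0; apply/subvP => x xK.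
  have : i x \in 0%VS by rewrite -iK0 memv_img.
  by rewrite !memv0 iE => /eqP x0; apply/eqP/val_inj; rewrite /= x0.
right; apply/eqP; rewrite eqEsubv subvf; apply/subvP => x _.
have : i x \in (i @: K)%VS by rewrite iKI iE subvsP.
by move=> /memv_imgP[y yK]; rewrite !iE => /val_inj ->.
Qed.

(** The inverse of the equivalence: it is simpler to write down than the
    equivalence itself, which needs the projections onto I and sigma I. *)
Definition swapped_sum (p : subvs_of I * subvs_of I) : g :=
  vsval p.1 + sigma (vsval p.2).

Fact swapped_sum_linear : linear swapped_sum.
Proof.
move=> a p q; rewrite /swapped_sum /= !linearP /=.
by rewrite scalerDr !addrA; congr (_ + _); rewrite -!addrA [X in _ + X]addrC.
Qed.
HB.instance Definition _ :=
  GRing.isLinear.Build F (subvs_of I * subvs_of I)%type g *:%R swapped_sum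
    swapped_sum_linear.

Let psi : 'Hom((subvs_of I * subvs_of I)%type, g) := linfun swapped_sum.

Let psiE p : psi p = vsval p.1 + sigma (vsval p.2).
Proof. by rewrite lfunE. Qed.

Let ker_psi : lker psi == 0%VS.
Proof.
rewrite -subv0; apply/subvP => -[x y]; rewrite memv_ker psiE memv0 /= => xy0.
have y0 : vsval y = 0.
  apply: swapped_ideal_eq0; rewrite ?subvsP //.
  by move: xy0; rewrite addrC addr_eq0 => /eqP->; rewrite memvN subvsP.
move: xy0; rewrite y0 linear0 addr0 => /eqP x0.
by apply/eqP; congr pair; apply: val_inj.
Qed.

Let limg_psi x : x \in limg psi.
Proof.
have [u [v [uI vI ->]]] := swapped_ideal_decomp x.
have -> : u + sigma v = psi (Subvs uI, Subvs vI) by rewrite psiE.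
by rewrite memv_img ?memvf.
Qed.

Let psi_lbr p q : psi [lie p, q] = [lie psi p, psi q].
Proof.
rewrite !psiE lbrDl !lbrDr swapped_ideal_comm ?subvsP // add0r.
rewrite -(involution_lbr _ _ _ si) [X in _ = _ + X + _]lbrC.
by rewrite swapped_ideal_comm ?subvsP // oppr0 addr0.
Qed.

Let intertwine_inv (f : 'End(g)) (h : 'End((subvs_of I * subvs_of I)%type)) :
  (forall p, psi (h p) = f (psi p)) -> (psi^-1 \o f = h \o psi^-1)%VF.
Proof.
move=> hf; apply/lfunP => x; rewrite !comp_lfunE.
by rewrite -{1}(limg_lfunVK (limg_psi x)) -hf lker0_lfunK.
Qed.

Lemma swapped_ideal_equiv (theta : 'End(g)) :
    (theta \o sigma = sigma \o theta)%VF -> stable_vs theta I ->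
  pair_equiv sigma theta (lie_swap (subvs_of I))
    (lfun_dsum (lfun_restr theta I) (lfun_restr theta I)).
Proof.
move=> ts tI; exists (psi^-1)%VF; split.
- have VK x : psi (psi^-1%VF x) = x by apply: limg_lfunVK; apply: limg_psi.
  split; first by exists psi => //; apply: lker0_lfunK.
  by move=> x y; apply: (lker0P ker_psi); rewrite psi_lbr !VK.
- by apply: intertwine_inv => p; rewrite lie_swapE !psiE linearD /= sK addrC.
- apply: intertwine_inv => p; rewrite lfun_dsumE !psiE /= !lfun_restrE //.
  rewrite linearD /=; congr (_ + _).
  by rewrite -!comp_lfunE ts.
Qed.

End Irreducible.

(** If I and theta I met trivially, then B(x, theta x) would vanish on I against
    positivity; their intersection is thus a nonzero ideal, and I is minimal. *)
Lemma swapped_ideal_theta_stable {R : realType} {g : lieAlgType R}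
    {sigma theta : 'End(g)} (I : lieIdeal g) :
    lie_involution sigma -> irreducible_pair sigma -> cartan_involution theta ->
    I <> 0%VS :> {vspace g} -> I <> fullv :> {vspace g} ->
  stable_vs theta I.
Proof.
move=> si irr [ti pos] I0 If; rewrite /stable_vs.
have [capE|capE] := swapped_ideal_minimal si irr I0 If
  (I :&: theta @: I)%VS (capvSl _ _)
  (fun x y _ => @idealP _ _ (cap_ideal I (img_ideal ti I)) x y).
  case: I0; apply/eqP; rewrite -subv0; apply/subvP => x xI; rewrite memv0.
  apply: contraT => /pos.
  by rewrite (killing_disjoint_ideals I (img_ideal ti I)) ?oppr0 ?ltxx ?memv_img.
apply/subvP => _ /memv_imgP[x xI ->].
by move: xI; rewrite -{1}capE memv_cap (mem_img_involution _ _ _ ti) => /andP[].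
Qed.

(** * The classification *)

Theorem corollary4p8 (R : realType) (g0 : lieAlgType R)
    (sigma theta : 'End(g0))
    (hpair : noncompact_semisimple_pair sigma theta)
    (hexcl : ~ (lie_simple g0 /\ ~ has_complex_structure g0))
    (hirr : irreducible_pair sigma) :
  (* (P-a) *)
  (lie_simple g0 /\
     exists J : 'End(g0), complex_structure J /\ complex_antilinear J sigma) \/
  (* (P-b) *)
  (lie_simple g0 /\
     exists J : 'End(g0), complex_structure J /\ complex_linear J sigma) \/
  (* (P-c) *)
  (exists I : lieIdeal g0,
     [/\ stable_vs theta I,
         lie_simple (subvs_of I),
         has_complex_structure (subvs_of I)
       & pair_equiv sigma theta
           (lie_swap (subvs_of I))
           (lfun_dsum (lfun_restr theta I) (lfun_restr theta I))]) \/
  (* (P-d) *)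
  (exists I : lieIdeal g0,
     [/\ stable_vs theta I,
         lie_simple (subvs_of I),
         ~ has_complex_structure (subvs_of I)
       & pair_equiv sigma theta
           (lie_swap (subvs_of I))
           (lfun_dsum (lfun_restr theta I) (lfun_restr theta I))]).
Proof.
have [ss nc si tc ts] := hpair.
have nab : ~ lie_abelian g0.
  (* A compact algebra may be zero, so non-compactness yields g0 <> 0. *)
  move=> ab; apply: nc => x /eqP[]; apply/eqP; rewrite -memv0.
  by rewrite -(semisimple_abelian_ideal full_ideal ss) ?memvf.
have [gs|ngs] := EM (lie_simple g0).
  have [J Jcs] : has_complex_structure g0.
    by apply: contrapT => nJ; apply: hexcl.
  have [Jlin|Janti] := complex_linear_or_antilinear gs _ _ Jcs si.
    by right; left; split=> //; exists J.
  by left; split=> //; exists J.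
have [I [I0 If]] := not_simple_proper_ideal nab ngs.
have tI := swapped_ideal_theta_stable I si hirr tc I0 If.
have Is := swapped_ideal_simple si hirr I0 If ss.
have Ieq := swapped_ideal_equiv si hirr I0 If theta ts tI.
by have [IJ|nIJ] := EM (has_complex_structure (subvs_of I));
  do 2 right; [left | right]; exists I.
Qed.
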